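(* Let $P$ be the probability measure on $\{1,2,3,4,5,6\}\subset\mathbb{R}$ with probability mass function $f(j)=2^{-j}$ for $j\in\{1,2,3,4,5\}$ and $f(6)=2^{-5}$. The optimal set of three-means for $P$ is $\{1,a[2,3],a[4,6]\}$, with quantization error $V_3(P)=\frac{65}{384}$.
   Context: For a Borel probability measure $P$ on $\mathbb{R}$ and a nonempty finite set $\alpha\subset\mathbb{R}$, the distortion error is $V(P;\alpha)=\int\min_{a\in\alpha}|x-a|^2\,dP(x)$. The $n$th quantization error is $V_n(P)=\inf\{V(P;\alpha):\alpha\subset\mathbb{R},\ 1\le\mathrm{card}(\alpha)\le n\}$, and a set $\alpha$ with $1\le\mathrm{card}(\alpha)\le n$ attaining this infimum is called an optimal set of $n$-means for $P$. For $i\le j$ in $\{1,\dots,6\}$, $a[i,j]=\dfrac{\sum_{k=i}^{j}k f(k)}{\sum_{k=i}^{j}f(k)}$. *)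

(* Defs.v *)
From HB Require Import structures.
From mathcomp Require Import all_boot all_order all_algebra finmap.
From mathcomp Require Import ring lra.
From mathcomp Require Import all_classical all_reals all_analysis.

Set Implicit Arguments.
Unset Strict Implicit.
Unset Printing Implicit Defensive.

Import Order.TTheory GRing.Theory Num.Theory.
Import numFieldNormedType.Exports.

Local Open Scope classical_set_scope.
Local Open Scope ring_scope.

Section quantization.
Context {R : realType}.
Implicit Types (P : probability (measurableTypeR R) R) (alpha : {fset R}).

(* The minimum is taken in \bar R so that +oo can serve as the neutral element
   of the iterated minimum; for nonempty alpha it is the usual minimum. *)
Definition sq_dist alpha (x : R) : \bar R :=
  \big[Order.min/+oo%E]_(a <- alpha) (`|x - a| ^+ 2)%:E.

Definition distortion P alpha : \bar R :=
  (\int[P]_x sq_dist alpha x)%E.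

Definition admissible (n : nat) alpha : bool := (1 <= #|` alpha| <= n)%N.

Definition quantization_error P (n : nat) : \bar R :=
  ereal_inf [set distortion P alpha | alpha in [set alpha | admissible n alpha]].

Definition optimal_set P (n : nat) alpha : Prop :=
  admissible n alpha /\ distortion P alpha = quantization_error P n.

End quantization.

Section six_points.
Context {R : realType}.

Definition six_point_pmf (j : nat) : R :=
  if (1 <= j <= 5)%N then 2 ^- j else if j == 6 then 2 ^- 5 else 0.

Lemma six_point_pmf_ge0 j : 0 <= six_point_pmf j.
Proof.
by rewrite /six_point_pmf; case: ifP => _; [|case: ifP => _];
  rewrite ?invr_ge0 ?exprn_ge0.
Qed.

Definition cond_mean (i j : nat) : R :=
  (\sum_(i <= k < j.+1) k%:R * six_point_pmf k) / (\sum_(i <= k < j.+1) six_point_pmf k).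

Definition six_point_prob : set (measurableTypeR R) -> \bar R :=
  msum (fun k => mscale (NngNum (six_point_pmf_ge0 k.+1))
                   (\d_(k.+1%:R : measurableTypeR R))) 6.

HB.instance Definition _ := Measure.on six_point_prob.

Let six_point_prob_setT : six_point_prob setT = 1%E.
Proof.
rewrite /six_point_prob /msum !big_ord_recr big_ord0 /= /mscale /=.
rewrite !diracE !mem_set// !mule1 add0e -!EFinD; congr EFin.
by rewrite /six_point_pmf /=; field.
Qed.

HB.instance Definition _ :=
  Measure_isProbability.Build _ _ R six_point_prob six_point_prob_setT.

Lemma six_point_prob1 (j : nat) : (1 <= j <= 6)%N ->
  six_point_prob [set j%:R] = (six_point_pmf j)%:E.
Proof.
move=> /andP[j1 j6].
have jP : (j.-1 < 6)%N by rewrite prednK.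
rewrite /six_point_prob /msum (bigD1 (Ordinal jP)) //= big1 => [|i ij].
  by rewrite adde0 /mscale /= diracE prednK// mem_set// mule1.
rewrite /mscale /= diracE memNset ?mule0//= => /eqP.
rewrite eqr_nat => /eqP ji; move/eqP: ij; apply.
by apply: val_inj; rewrite /= -ji.
Qed.

End six_points.

(* Main.v *)
(** Among three sorted points, the nearest one to x is determined by comparing x
    with the two midpoints, so a codebook splits {1,...,6} into three consecutive
    (possibly empty) clusters. By Huygens' identity a cluster costs least at its
    conditional mean, strictly so when its mass is positive; comparing the 28
    splittings, {1}, {2,3}, {4,5,6} is the unique best one. *)
Require Import Defs.
From HB Require Import structures.
From mathcomp Require Import all_boot all_order all_algebra finmap.
From mathcomp Require Import ring lra zify.
From mathcomp Require Import all_classical all_reals all_analysis.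
From mathcomp Require Import measurable_realfun.

Import Order.TTheory GRing.Theory Num.Theory.
Local Open Scope ring_scope.

Section six_point_clusters.
Context {R : realType}.
Local Notation f := (@six_point_pmf R).

(** * Costs of clusters of consecutive atoms *)

Definition cluster_cost (m n : nat) (a : R) : R :=
  \sum_(m <= j < n.+1) f j * (j%:R - a) ^+ 2.

(* A cluster of zero mass is no exception: there the cost vanishes and
   [cond_mean m n] is the junk value 0. *)
Lemma cluster_cost_huygens m n a :
  cluster_cost m n a = cluster_cost m n (cond_mean m n) +
    (\sum_(m <= j < n.+1) f j) * (a - cond_mean m n) ^+ 2.
Proof.
set w := \sum_(m <= j < n.+1) f j; set g := cond_mean m n.
have wg : \sum_(m <= j < n.+1) j%:R * f j = w * g.
  have [w0|w0] := eqVneq w 0; last by rewrite mulrC divfK.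
  rewrite w0 mul0r big_seq big1// => j jmn.
  have /eqP := w0; rewrite /w big_seq psumr_eq0; last first.
    by move=> ? _; exact: six_point_pmf_ge0.
  by move=> /allP/(_ j jmn)/implyP/(_ jmn)/eqP ->; rewrite mulr0.
(* The summand is [f j] times (j - a)^2 - (j - g)^2, arranged so that summation leaves only the mass
   [w] and the first moment [w * g]. *)
have -> : w * (a - g) ^+ 2 = \sum_(m <= j < n.+1)
   (f j * (a ^+ 2 - g ^+ 2) + j%:R * f j * (2 * (g - a))).
  by rewrite big_split/= -!mulr_suml wg -/w; ring.
by rewrite /cluster_cost -big_split/=; apply: eq_bigr => j _; ring.
Qed.

(* Row m - 1, column n holds the minimal cost of the cluster {m,...,n}, that is
   0 when it has at most one point. *)
Let sse_table : seq (seq R) := [::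
  [:: 0; 0; 1 / 6; 13 / 28; 97 / 120; 561 / 496; 1695 / 1024];
  [:: 0; 0; 0; 1 / 12; 13 / 56; 97 / 240; 367 / 512];
  [:: 0; 0; 0; 0; 1 / 24; 13 / 112; 71 / 256];
  [:: 0; 0; 0; 0; 0; 1 / 48; 11 / 128];
  [:: 0; 0; 0; 0; 0; 0; 1 / 64]].

(** The value [m = 7] covers the empty last cluster of a splitting with [k = 6]. For [m] equal to 6
    or 7 the table has no row, and the [nth] defaults return the correct cost 0. *)
Lemma cluster_cost_table m n : (1 <= m <= 7)%N -> (n <= 6)%N ->
  cluster_cost m n (cond_mean m n) = nth 0 (nth [::] sse_table m.-1) n.
Proof.
move=> /andP[m0 m7] n6; have [nm|mn] := ltnP n m.
  rewrite /cluster_cost big_geq//; apply/esym.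
  case: m m0 m7 nm => [|[|[|[|[|[|[|[|m]]]]]]]] // _ _;
    by case: n n6 => [|[|[|[|[|[|[|n]]]]]]].
case: m m0 m7 mn => [|[|[|[|[|[|[|[|m]]]]]]]] // _ _;
  case: n n6 => [|[|[|[|[|[|[|n]]]]]]] // _ _;
  rewrite /cluster_cost /cond_mean unlock /= /six_point_pmf /=; by field.
Qed.

(** Checks the 27 competing splittings; strictness is what later gives uniqueness. The excluded one
    costs 0 + 1/12 + 11/128 = 65/384. *)
Lemma split_cost_gt i k : (i <= k <= 6)%N -> (i, k) != (1%N, 3) ->
  65 / 384 < cluster_cost 1 i (cond_mean 1 i) +
    cluster_cost i.+1 k (cond_mean i.+1 k) +
    cluster_cost k.+1 6 (cond_mean k.+1 6).
Proof.
move=> /andP[ik k6]; have i6 := leq_trans ik k6.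
rewrite !cluster_cost_table//.
case: k i {i6} k6 ik => [|[|[|[|[|[|[|k]]]]]]] [|[|[|[|[|[|[|i]]]]]]] //= _ _ _; lra.
Qed.

(** * Distortion as a finite sum over the atoms *)

Lemma measurable_sq_dist (alpha : {fset R}) :
  measurable_fun [set: measurableTypeR R] (sq_dist alpha).
Proof.
rewrite /sq_dist; elim: (enum_fset alpha) => [|a s IHs].
  by under eq_fun do rewrite big_nil; exact: measurable_cst.
under eq_fun do rewrite big_cons.
apply: measurable_mine => //; apply/measurable_EFinP.
under eq_fun do rewrite real_normK ?num_real//.
by apply: measurable_funX; apply: measurable_funB.
Qed.

Lemma sq_dist_ge0 (alpha : {fset R}) (x : R) : (0 <= sq_dist alpha x)%E.
Proof.
rewrite /sq_dist; apply: (big_ind (fun y => 0 <= y)%E) => // y z y0 z0.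
by rewrite le_min y0 z0.
Qed.

Lemma distortion_six_point_prob (alpha : {fset R}) :
  distortion six_point_prob alpha =
  (\sum_(1 <= j < 7) (f j)%:E * sq_dist alpha j%:R)%E.
Proof.
rewrite /distortion /six_point_prob ge0_integral_measure_sum//; last first.
- exact: measurable_sq_dist.
- by move=> x _; exact: sq_dist_ge0.
rewrite big_add1 big_mkord; apply: eq_bigr => i _.
rewrite ge0_integral_mscale//; last first.
- by move=> x _; exact: sq_dist_ge0.
- exact: measurable_sq_dist.
by rewrite integral_dirac//; [rewrite diracT mul1e | exact: measurable_sq_dist].
Qed.

Lemma sq_dist_nearest (alpha : {fset R}) (x t : R) :
  t \in alpha -> (forall a, a \in alpha -> (x - t) ^+ 2 <= (x - a) ^+ 2) ->
  sq_dist alpha x = ((x - t) ^+ 2)%:E.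
Proof.
move=> talpha tmin; apply/eqP; rewrite eq_le; apply/andP; split.
  apply: (@bigmin_inf_seq _ _ _ _ _ t) => //.
  by rewrite real_normK ?num_real.
rewrite /sq_dist big_seq; apply: (big_ind (fun y => _ <= y)%E) => //.
- exact: leey.
- by move=> y z ty tz; rewrite le_min ty tz.
- by move=> a /tmin ta; rewrite lee_fin (real_normK (num_real _)).
Qed.

(** * Sorted codebooks and the splittings they induce *)

Lemma sq_dist_sorted3 (a b c x : R) : a <= b -> b <= c ->
  sq_dist [fset a; b; c]%fset x =
  (if x <= (a + b) / 2 then (x - a) ^+ 2
   else if x <= (b + c) / 2 then (x - b) ^+ 2 else (x - c) ^+ 2)%:E.
Proof.
move=> ab bc.
(* Each comparison is the sign of a product such as (x - b)^2 - (x - a)^2 = (b - a)(a + b - 2x). *)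
case: leP => [xab|abx]; last case: leP => [xbc|bcx];
  apply: sq_dist_nearest; rewrite ?inE ?eqxx ?orbT// => d;
  rewrite !inE -orbA => /or3P[]/eqP -> //; nra.
Qed.

(** A codebook with one or two points is padded by repeating a point, hence the non-strict
    inequalities. *)
Lemma fset3_sorted (alpha : {fset R}) : admissible 3 alpha ->
  exists a b c, [/\ a <= b, b <= c & alpha = [fset a; b; c]%fset].
Proof.
move=> card.
have := sort_sorted (@le_total _ R) alpha.
have := mem_sort (<=%R : rel R) alpha.
have := size_sort (<=%R : rel R) alpha.
move: card; rewrite /admissible -[X in (_ <= X <= _)%N]/(size alpha).
move=> /[swap] <-.
case: (sort _ _) => [|a [|b [|c []]]] //= _ smem.
- move=> _; exists a, a, a; split => //.
  by apply/fsetP => x; rewrite -smem !inE !orbb.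
- rewrite andbT => ab; exists a, b, b; split => //.
  by apply/fsetP => x; rewrite -smem !inE -orbA orbb.
- move=> /and3P[ab bc _]; exists a, b, c; split => //.
  by apply/fsetP => x; rewrite -smem !inE orbA.
Qed.

(** The integers of {1,...,n} below [t] form an initial segment, with [i = 0] when there are
    none. *)
Lemma threshold_index (t : R) n : exists2 i, (i <= n)%N &
  forall j, (1 <= j <= n)%N -> (j%:R <= t) = (j <= i)%N.
Proof.
elim: n => [|n [i ile it]]; first by exists 0%N => // -[|j] //.
have [tn|tn] := leP n.+1%:R t.
  exists n.+1 => // j /andP[_ jn]; rewrite jn.
  by apply: le_trans tn; rewrite ler_nat.
exists i; first exact: leqW.
move=> j /andP[j1]; rewrite leq_eqVlt => /orP[/eqP ->|jn].
  by rewrite leNgt tn/=; apply/esym/negbTE; rewrite -ltnNge.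
by apply: it; rewrite j1.
Qed.

Lemma distortion_clusters (a b c : R) i k : a <= b -> b <= c -> (i <= k <= 6)%N ->
  (forall j, (1 <= j <= 6)%N -> (j%:R <= (a + b) / 2) = (j <= i)%N) ->
  (forall j, (1 <= j <= 6)%N -> (j%:R <= (b + c) / 2) = (j <= k)%N) ->
  distortion six_point_prob [fset a; b; c]%fset =
  (cluster_cost 1 i a + cluster_cost i.+1 k b + cluster_cost k.+1 6 c)%:E.
Proof.
move=> ab bc /andP[ik k6] iab kbc.
have ik1 : (i < k.+1)%N by [].
rewrite distortion_six_point_prob.
rewrite (big_cat_nat (n := k.+1))//= (big_cat_nat (n := i.+1))//=.
rewrite !EFinD /cluster_cost -!sumEFin; congr (_ + _ + _)%E;
  apply: eq_big_nat => j /andP[j1 j2];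
  have j16 : (1 <= j <= 6)%N by lia.
- by rewrite sq_dist_sorted3// iab// -ltnS j2.
- by rewrite sq_dist_sorted3// iab// kbc// leqNgt j1/= -ltnS j2.
- by rewrite sq_dist_sorted3// iab// kbc// [(j <= k)%N]leqNgt j1/=
    leqNgt (leq_ltn_trans ik j1).
Qed.

Lemma distortion_fset3 (a b c : R) : a <= b -> b <= c -> exists i k,
  (i <= k <= 6)%N /\ distortion six_point_prob [fset a; b; c]%fset =
  (cluster_cost 1 i a + cluster_cost i.+1 k b + cluster_cost k.+1 6 c)%:E.
Proof.
move=> ab bc.
have [i i6 iab] := threshold_index ((a + b) / 2) 6.
have [k k6 kbc] := threshold_index ((b + c) / 2) 6.
have ik : (i <= k)%N.
  (* The threshold property speaks only of indices from 1 on, so [i = 0] is split off; otherwise the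
     atom [i] lies below the first midpoint, hence below the second. *)
  case: i i6 iab => // i i6 iab.
  rewrite -kbc//; apply: le_trans (_ : (a + b) / 2 <= _); first by rewrite iab/=.
  lra.
by exists i, k; rewrite ik k6; split => //; apply: distortion_clusters; rewrite ?ik.
Qed.

(** * The optimal splitting and its uniqueness *)

Lemma cond_mean11 : cond_mean 1 1 = 1 :> R.
Proof. by rewrite /cond_mean unlock/= /six_point_pmf/=; field. Qed.

Lemma cond_mean23 : cond_mean 2 3 = 7 / 3 :> R.
Proof. by rewrite /cond_mean unlock/= /six_point_pmf/=; field. Qed.

Lemma cond_mean46 : cond_mean 4 6 = 19 / 4 :> R.
Proof. by rewrite /cond_mean unlock/= /six_point_pmf/=; field. Qed.

Lemma optimal_split_cost :
  cluster_cost 1 1 1 + cluster_cost 2 3 (cond_mean 2 3) +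
  cluster_cost 4 6 (cond_mean 4 6) = 65 / 384 :> R.
Proof. by rewrite -{1}cond_mean11 !cluster_cost_table//=; lra. Qed.

Lemma le_cluster_cost m n (a : R) :
  cluster_cost m n (cond_mean m n) <= cluster_cost m n a.
Proof.
rewrite [leRHS]cluster_cost_huygens lerDl mulr_ge0 ?sqr_ge0//.
by apply: sumr_ge0 => j _; exact: six_point_pmf_ge0.
Qed.

Lemma cluster_costs_ge i k (a b c : R) : (i <= k <= 6)%N ->
  65 / 384 <= cluster_cost 1 i a + cluster_cost i.+1 k b + cluster_cost k.+1 6 c.
Proof.
move=> ik6; apply: le_trans (lerD (lerD (le_cluster_cost 1 i a)
  (le_cluster_cost i.+1 k b)) (le_cluster_cost k.+1 6 c)).
have [[-> ->]|ik] := eqVneq (i, k) (1%N, 3); last exact/ltW/split_cost_gt.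
by rewrite cond_mean11 optimal_split_cost.
Qed.

Lemma cluster_costs_eq i k (a b c : R) : (i <= k <= 6)%N ->
  cluster_cost 1 i a + cluster_cost i.+1 k b + cluster_cost k.+1 6 c = 65 / 384 ->
  [/\ a = 1, b = cond_mean 2 3 & c = cond_mean 4 6].
Proof.
move=> ik6; have [[-> ->]|ik] := eqVneq (i, k) (1%N, 3); last first.
  move=> abcE; have := lerD (lerD (le_cluster_cost 1 i a)
    (le_cluster_cost i.+1 k b)) (le_cluster_cost k.+1 6 c).
  by rewrite abcE leNgt split_cost_gt.
rewrite (cluster_cost_huygens 1 1 a) (cluster_cost_huygens 2 3 b).
rewrite (cluster_cost_huygens 4 6 c) cond_mean11 => abc.
have := optimal_split_cost; move: abc.
have := sqr_ge0 (a - 1); have := sqr_ge0 (b - cond_mean 2 3).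
have := sqr_ge0 (c - cond_mean 4 6).
(* The excess over 65/384 is a combination of three squares whose weights, the cluster masses, are
   positive; as it vanishes, so does each square. *)
have [-> -> ->] : [/\ \sum_(1 <= j < 2) f j = 1 / 2,
    \sum_(2 <= j < 4) f j = 3 / 8 & \sum_(4 <= j < 7) f j = 1 / 8].
  by rewrite unlock/= /six_point_pmf/=; split; field.
by split; apply/eqP; rewrite -subr_eq0 -sqrf_eq0; apply/eqP; lra.
Qed.

Lemma admissible_fset3 (a b c : R) : admissible 3 [fset a; b; c]%fset.
Proof.
apply/andP; split.
  by rewrite cardfs_gt0; apply/fset0Pn; exists a; rewrite !inE eqxx.
by rewrite !cardfsU !cardfs1; lia.
Qed.

Lemma distortion_optimal_split :
  distortion six_point_prob [fset (1 : R); cond_mean 2 3; cond_mean 4 6]%fset =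
  (65 / 384)%:E.
Proof.
(* The midpoints 5/3 and 85/24 lie in (1, 2) and (3, 4), whence the thresholds 1 and 3. *)
rewrite (@distortion_clusters _ _ _ 1 3) ?optimal_split_cost//;
  rewrite ?cond_mean23 ?cond_mean46; [lra|lra| |];
  by case=> [|[|[|[|[|[|[|j]]]]]]] //= _; apply/idP/idP => //; lra.
Qed.

Lemma quantization_error_six_point_prob :
  quantization_error (@six_point_prob R) 3 = (65 / 384)%:E.
Proof.
apply/eqP; rewrite eq_le; apply/andP; split.
  rewrite -distortion_optimal_split; apply: ereal_inf_lbound.
  by exists [fset (1 : R); cond_mean 2 3; cond_mean 4 6]%fset => //;
    exact: admissible_fset3.
apply: le_ereal_inf_tmp => _ [alpha /fset3_sorted[a [b [c [ab bc ->]]]] <-].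
have [i [k [ik6 ->]]] := distortion_fset3 _ _ _ ab bc.
by rewrite lee_fin cluster_costs_ge.
Qed.

End six_point_clusters.

Theorem proposition3p3 (R : realType) :
  (forall alpha : {fset R},
     optimal_set (@six_point_prob R) 3 alpha <->
     alpha = [fset (1 : R); cond_mean 2 3; cond_mean 4 6]%fset) /\
  quantization_error (@six_point_prob R) 3 = (65 / 384)%:E.
Proof.
split=> [alpha|]; last exact: quantization_error_six_point_prob.
rewrite /optimal_set quantization_error_six_point_prob; split; last first.
  by move=> ->; split; [exact: admissible_fset3|exact: distortion_optimal_split].
move=> [/fset3_sorted[a [b [c [ab bc ->]]]]].
have [i [k [ik6 ->]]] := distortion_fset3 _ _ _ ab bc => -[].
by move=> /(cluster_costs_eq _ _ _ _ _ ik6)[-> -> ->].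
Qed.
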